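(* On HDAs over $\Sigma$, hhp-bisimilarity is strictly contained in hqhp-bisimilarity: ${\underline{\leftrightarrow}_{hhp}}\subsetneq{\underline{\leftrightarrow}_{hqhp}}$.
   Context: HDAs. $\Sigma$ is a fixed set of actions, containing pairwise distinct actions $a,b,c,d$. A conclist is $U=(n,\lambda)$ with $n\in\mathbb N$ and $\lambda:\{1<\dots<n\}\to\Sigma$. The category $\square$ has conclists as objects; a morphism $(m,\lambda)\to(n,\mu)$ is a pair $(f,\varepsilon)$ with $f:\{1,\dots,m\}\to\{1,\dots,n\}$ injective, order- and label-preserving, and $\varepsilon:\{1,\dots,n\}\to\{0,*,1\}$ with $\varepsilon^{-1}( * )=\mathrm{im} f$; composition is $(g,\zeta)\circ(f,\varepsilon)=(g\circ f,\eta)$ with $\eta(g(t))=\varepsilon(t)$ and $\eta(u)=\zeta(u)$ for $u\notin\mathrm{im}\,g$. For $1\le i\le n$, $k\in\{0,1\}$, the coface map $d_i^k:U\to V$ ($V$ of dimension $n$, $U$ of dimension $n-1$) has $f$ omitting position $i$, $\varepsilon(i)=k$, and $\varepsilon(j)=*$ for $j\ne i$. A precubical set is a functor $X:\square^{op}\to\mathbf{Set}$; elements of $X[U]$, $U=(n,\lambda)$, are $n$-dimensional cells, and $\delta_i^k:=X[d_i^k]$. An HDA is a pair $(X,i)$ of a precubical set and an initial $0$-dimensional cell $i$. Paths. A path of an HDA $\mathcal X$ is a sequence $\alpha=(x_0,\varphi_1,x_1,\dots,\varphi_n,x_n)$ ($n\ge 0$) with $x_0$ the initial cell, $x_j\in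 X[U_j]$, where for each $j$ either $\varphi_j=d^0_{i_j}:U_{j-1}\to U_j$ with $x_{j-1}=\delta^0_{i_j}(x_j)$ (up-step, starting an event) or $\varphi_j=d^1_{i_j}:U_j\to U_{j-1}$ with $x_j=\delta^1_{i_j}(x_{j-1})$ (down-step, ending an event). $\alpha\hookrightarrow\alpha'$ means $\alpha$ is a prefix of $\alpha'$. $\alpha\leftrightarrows^\ell\beta$ ($\ell$-similarity): one of $\alpha,\beta$ is obtained from the other by replacing, around the cell $x_\ell$, $(d_i^0,x_\ell,d_j^0)$ by $(d_{j-1}^0,x'_\ell,d_i^0)$, or $(d_j^1,x_\ell,d_i^1)$ by $(d_i^1,x'_\ell,d_{j-1}^1)$, for some $i<j$ and some cell $x'_\ell$. $\alpha\sqsubseteq^\ell\beta$ ($\beta$ subsumes $\alpha$ at $\ell$): $\alpha$ is obtained from $\beta$ by replacing, around $x_\ell$, $(d_i^0,x_\ell,d_j^1)$ by $(d_{j-1}^1,x'_\ell,d_i^0)$, or $(d_j^0,x_\ell,d_i^1)$ by $(d_i^1,x'_\ell,d_{j-1}^0)$, for some $i<j$. ST-traces. Given a down-step at position $p$ of a path, move it to the left: as long as the step directly before it is a down-step, or an up-step whose index differs from the current index of the moving down-step, there is a unique replacement moving it one position left: for some $i<j$ and cells $x,x'$, it replaces $(d_j^1,x,d_i^1)$ by $(d_i^1,x',d_{j-1}^1)$ or conversely (if the step directly before is a down-step), or it replaces $(d_i^0,x,d_j^1)$ by $(d_{j-1}^1,x',d_i^0)$ or $(d_j^0,x,d_i^1)$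 by $(d_i^1,x',d_{j-1}^0)$ (if the step directly before is an up-step). This stops when the step directly before it, at position $k$, is an up-step with the same index; put $\mathrm{start}(p)=k$. $\mathsf{ST}(\alpha)$ is the sequence whose $j$-th entry is $a^+$ if $\varphi_j$ is an up-step starting an event labelled $a$ (the label of the $i_j$-th event of $U_j$), and $a^{\mathrm{start}(j)}$ if $\varphi_j$ is a down-step ending an event labelled $a$ (the label of the $i_j$-th event of $U_{j-1}$). $I$-bisimulations. For $I\subseteq\{\sqsubseteq,\sqsupseteq,\leftrightarrows,\hookleftarrow\}$, an $I$-bisimulation between HDAs $\mathcal Y,\mathcal Z$ is a relation $\mathfrak R$ between paths of $\mathcal Y$ and of $\mathcal Z$ satisfying the following clauses, each also with the roles of $\mathcal Y$ and $\mathcal Z$ exchanged: (1) the length-$0$ paths of $\mathcal Y$ and $\mathcal Z$ are related; (2) if $(\alpha,\beta)\in\mathfrak R$ then $\mathsf{ST}(\alpha)=\mathsf{ST}(\beta)$; (3) if $(\alpha,\beta)\in\mathfrak R$ and $\alpha\hookrightarrow\alpha'$, there is $\beta'$ with $\beta\hookrightarrow\beta'$ and $(\alpha',\beta')\in\mathfrak R$; and those of the following whose symbol lies in $I$: ($\sqsubseteq$) if $(\alpha,\beta)\in\mathfrak R$ and $\alpha\sqsubseteq^\ell\alpha'$, there is $\beta'$ with $\beta\sqsubseteq^\ell\beta'$, $(\alpha',\beta')\in\mathfrak R$; ($\sqsupseteq$) the same with $\alpha'\sqsubseteq^\ell\alpha$ and $\beta'\sqsubseteq^\ell\beta$; ($\leftrightarrows$)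 the same with $\alpha'\leftrightarrows^\ell\alpha$ and $\beta'\leftrightarrows^\ell\beta$; ($\hookleftarrow$) the same with $\alpha'\hookrightarrow\alpha$ and $\beta'\hookrightarrow\beta$. $\mathcal Y,\mathcal Z$ are $I$-bisimilar, $\mathcal Y\,\underline{\leftrightarrow}_I\,\mathcal Z$, if an $I$-bisimulation between them exists. Names: hqhp is $I=\{\sqsubseteq,\leftrightarrows,\hookleftarrow\}$; hhp is $I=\{\sqsubseteq,\sqsupseteq,\leftrightarrows,\hookleftarrow\}$. *)

(* Defs.v *)
From mathcomp Require Import all_boot.

Set Implicit Arguments.
Unset Strict Implicit.
Unset Printing Implicit Defensive.

(* Positions in a conclist are counted from 0, so the i-th event of the usual
   1-based convention is the event at position i.-1; steps of a path are
   counted from 1, so that step [j] leads from the cell x_(j-1) to x_j. *)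
Record conclist (S : Type) := Conclist {
  dim : nat;
  lab : {ffun 'I_dim -> S}
}.

(* {0, *, 1} is encoded by [Some false], [None], [Some true]. *)
Record hom (S : Type) (U V : conclist S) := Hom {
  hom_fun : {ffun 'I_(dim U) -> 'I_(dim V)};
  hom_eps : {ffun 'I_(dim V) -> option bool};
  hom_inj : injective hom_fun;
  hom_mono : {homo hom_fun : i j / (i <= j)%N};
  hom_lab : forall i, lab V (hom_fun i) = lab U i;
  hom_star : forall u, (hom_eps u == None) = (u \in codom hom_fun)
}.

Section Category.
Variable S : Type.
Implicit Types U V W : conclist S.

Section Identity.
Variable U : conclist S.

Let id_fun : {ffun 'I_(dim U) -> 'I_(dim U)} := [ffun i => i].
Let id_eps : {ffun 'I_(dim U) -> option bool} := [ffun=> None].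

Fact id_inj : injective id_fun.
Proof. by move=> i j; rewrite !ffunE. Qed.

Fact id_mono : {homo id_fun : i j / (i <= j)%N}.
Proof. by move=> i j; rewrite !ffunE. Qed.

Fact id_lab i : lab U (id_fun i) = lab U i.
Proof. by rewrite ffunE. Qed.

Fact id_star u : (id_eps u == None) = (u \in codom id_fun).
Proof. by rewrite ffunE; symmetry; apply/codomP; exists u; rewrite ffunE. Qed.

Definition hom_id : hom U U := Hom id_inj id_mono id_lab id_star.

End Identity.

Section Composition.
Variables (U V W : conclist S) (g : hom V W) (f : hom U V).

Let comp_fun : {ffun 'I_(dim U) -> 'I_(dim W)} :=
  [ffun i => hom_fun g (hom_fun f i)].
Let comp_eps : {ffun 'I_(dim W) -> option bool} :=
  [ffun u => if [pick t | hom_fun g t == u] is Some t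
             then hom_eps f t else hom_eps g u].

Fact comp_inj : injective comp_fun.
Proof. by move=> i j; rewrite !ffunE => /hom_inj /hom_inj. Qed.

Fact comp_mono : {homo comp_fun : i j / (i <= j)%N}.
Proof. by move=> i j le_ij; rewrite !ffunE; do 2!apply: hom_mono. Qed.

Fact comp_lab i : lab W (comp_fun i) = lab U i.
Proof. by rewrite ffunE !hom_lab. Qed.

Fact comp_star u : (comp_eps u == None) = (u \in codom comp_fun).
Proof.
rewrite ffunE; case: pickP => [t /eqP <-|no_t]; rewrite hom_star.
  apply/codomP/codomP => [[i ->]|[i]]; first by exists i; rewrite ffunE.
  by rewrite ffunE => /hom_inj ->; exists i.
apply/codomP/codomP => [[t def_u]|[i]]; first by have:= no_t t; rewrite def_u eqxx.
by rewrite ffunE => def_u; have:= no_t (hom_fun f i); rewrite def_u eqxx.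
Qed.

Definition hom_comp : hom U W := Hom comp_inj comp_mono comp_lab comp_star.

End Composition.

Section Coface.
Variables (V : conclist S) (i : 'I_(dim V)) (k : bool).

Definition del : conclist S :=
  @Conclist S (dim V).-1 [ffun j => lab V (lift i j)].

Let coface_fun : {ffun 'I_(dim del) -> 'I_(dim V)} := [ffun j => lift i j].
Let coface_eps : {ffun 'I_(dim V) -> option bool} :=
  [ffun j => if j == i then Some k else None].

Fact coface_inj : injective coface_fun.
Proof. by move=> j l; rewrite !ffunE => /lift_inj. Qed.

Fact coface_mono : {homo coface_fun : j l / (j <= l)%N}.
Proof. by move=> j l; rewrite !ffunE /= leq_bump2. Qed.

Fact coface_lab j : lab V (coface_fun j) = lab del j.
Proof. by rewrite !ffunE. Qed.

Fact coface_star u : (coface_eps u == None) = (u \in codom coface_fun).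
Proof.
rewrite ffunE; apply/idP/codomP => [|[j ->]].
  case: (unliftP i u) => [j ->|->]; last by rewrite eqxx.
  by exists j; rewrite ffunE.
by rewrite ffunE; have := neq_lift i j; rewrite eq_sym => /negPf ->.
Qed.

Definition coface : hom del V :=
  Hom coface_inj coface_mono coface_lab coface_star.

End Coface.
End Category.

Record precubical (S : Type) := Precubical {
  pc_obj :> conclist S -> Type;
  pc_map : forall U V, hom U V -> pc_obj V -> pc_obj U;
  pc_id : forall U (x : pc_obj U), pc_map (hom_id U) x = x;
  pc_comp : forall U V W (g : hom V W) (f : hom U V) (x : pc_obj W),
    pc_map (hom_comp g f) x = pc_map f (pc_map g x)
}.

Definition face (S : Type) (X : precubical S) (V : conclist S)
    (i : 'I_(dim V)) (k : bool) (x : X V) : X (del i) :=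
  pc_map (coface i k) x.

Definition cell (S : Type) (X : precubical S) : Type := {U : conclist S & X U}.

Record hda (S : Type) := Hda {
  hda_pc :> precubical S;
  init : cell hda_pc;
  init_dim : dim (tag init) = 0
}.

(* [up i] and [down i] stand for the coface maps d_i^0 and d_i^1 into the
   larger of the two neighbouring conclists of a path. *)
Inductive move := up of nat | down of nat.

Section Paths.
Variables (S : Type) (X : hda S).
Implicit Types (x y : cell X) (s : seq (move * cell X)).

(* y = delta_i^k(x) *)
Definition is_face (i : nat) (k : bool) y x : Prop :=
  exists lt_i : i < dim (tag x),
    y = existT _ (del (Ordinal lt_i)) (face (Ordinal lt_i) k (tagged x)).

Definition is_step x (phi : move) y : Prop :=
  match phi with
  | up i => is_face i false x y
  | down i => is_face i true y x
  end.

Fixpoint is_path x s : Prop :=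
  if s is (phi, y) :: s' then is_step x phi y /\ is_path y s' else True.

(* The path (x_0, phi_1, x_1, ..., phi_n, x_n) is given by the sequence of the
   pairs (phi_j, x_j), as x_0 is always the initial cell. *)
Record hda_path := HdaPath {
  steps : seq (move * cell X);
  stepsP : is_path (init X) steps
}.

Definition path0 : hda_path := @HdaPath [::] I.

Definition path_prefix (alpha alpha' : hda_path) : Prop :=
  exists s, steps alpha' = steps alpha ++ s.

(* beta arises from alpha by replacing (phi, x_l, psi) by (phi', x'_l, psi')
   around the cell at position l, where [rule (phi, psi) (phi', psi')]. *)
Definition replaced (rule : move * move -> move * move -> Prop) (l : nat)
    (alpha beta : hda_path) : Prop :=
  exists (s t : seq (move * cell X)) (phi psi phi' psi' : move)
      (x x' y : cell X),
    [/\ (size s).+1 = l,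
        rule (phi, psi) (phi', psi'),
        steps alpha = s ++ (phi, x) :: (psi, y) :: t
      & steps beta = s ++ (phi', x') :: (psi', y) :: t].

End Paths.

Inductive sim_rule : move * move -> move * move -> Prop :=
| sim_up i j : i < j -> sim_rule (up i, up j) (up j.-1, up i)
| sim_down i j : i < j -> sim_rule (down j, down i) (down i, down j.-1).

Inductive sub_rule : move * move -> move * move -> Prop :=
| sub_lt i j : i < j -> sub_rule (up i, down j) (down j.-1, up i)
| sub_gt i j : i < j -> sub_rule (up j, down i) (down i, up j.-1).

Definition similar (S : Type) (X : hda S) (l : nat) (alpha beta : hda_path X)
  : Prop := replaced sim_rule l alpha beta \/ replaced sim_rule l beta alpha.

(* beta subsumes alpha at l *)
Definition subsumed (S : Type) (X : hda S) (l : nat) (alpha beta : hda_path X)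
  : Prop := replaced sub_rule l beta alpha.

(* The replacement that moves the down-step [psi] in front of the step [phi]
   directly before it, if there is one.  Only the coface maps are recorded:
   they alone decide which replacement applies and what it does to the
   indices. *)
Definition move_left (phi psi : move) : option (move * move) :=
  match phi, psi with
  | down j, down i =>
      if i < j then Some (down i, down j.-1) else Some (down i.+1, down j)
  | up i, down j =>
      if i < j then Some (down j.-1, up i)
      else if j < i then Some (down j, up i.-1)
      else None
  | _, up _ => None
  end.

Lemma move_leftP (phi : move) (i : nat) (p : move * move) :
  move_left phi (down i) = Some p <->
  [\/ sim_rule (phi, down i) p, sim_rule p (phi, down i)
    | sub_rule (phi, down i) p].
Proof.
split.
  case: phi => j /=.
    case: ltngtP => // lt_ij [<-]; apply: Or33; by constructor.
  case: ltnP => [lt_ij [<-]|le_ji [<-]]; first by apply: Or31; constructor.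
  by apply: Or32; apply: (@sim_down j i.+1).
case=> H; inversion H as [i' j' lt_ij|i' j' lt_ij]; subst => /=.
- by rewrite lt_ij.
- by case: j' {H} lt_ij => // j' le_ij; rewrite /= ltnNge -ltnS le_ij.
- by rewrite lt_ij.
- by case: ltngtP lt_ij.
Qed.

(* [past] lists, last first, the steps before the down-step [psi]; the result
   is the position of the step that [psi] is stopped by.  On a path the case of
   an empty [past] does not arise, as the initial cell has dimension 0. *)
Fixpoint start (past : seq move) (psi : move) : nat :=
  if past is phi :: past' then
    if move_left phi psi is Some (psi', _) then start past' psi' else size past
  else 0.

(* [ST_start a] is a^+ and [ST_end a k] is a^k. *)
Inductive ST_letter (A : Type) := ST_start of A | ST_end of A & nat.
Arguments ST_start {A}.
Arguments ST_end {A}.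

Section STTraces.
Variables (S : Type) (X : hda S).

(* The label of the event at position i of the conclist of x; it is [None]
   only if there is no such event, which does not occur in the steps of a
   path. *)
Definition label (x : cell X) (i : nat) : option S :=
  omap (lab (tag x)) (insub i).

Fixpoint ST_from (past : seq move) (x : cell X) (s : seq (move * cell X))
  : seq (ST_letter (option S)) :=
  if s is (phi, y) :: s' then
    match phi with
    | up i => ST_start (label y i)
    | down i => ST_end (label x i) (start past phi)
    end :: ST_from (phi :: past) y s'
  else [::].

Definition ST (alpha : hda_path X) : seq (ST_letter (option S)) :=
  ST_from [::] (init X) (steps alpha).

End STTraces.

(* Respectively: alpha subsumed by alpha', alpha subsuming alpha', similarity,
   and backward prefix. *)
Inductive clause := CSub | CSup | CSim | CBack.

(* The clauses of an I-bisimulation, read from Y to Z. *)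
Definition half_bisimulation (S : Type) (I : clause -> Prop) (Y Z : hda S)
    (R : hda_path Y -> hda_path Z -> Prop) : Prop :=
  R (path0 Y) (path0 Z) /\
  forall alpha beta, R alpha beta ->
    [/\ ST alpha = ST beta,
        forall alpha', path_prefix alpha alpha' ->
          exists2 beta', path_prefix beta beta' & R alpha' beta',
        I CSub -> forall l alpha', subsumed l alpha alpha' ->
          exists2 beta', subsumed l beta beta' & R alpha' beta',
        I CSup -> forall l alpha', subsumed l alpha' alpha ->
          exists2 beta', subsumed l beta' beta & R alpha' beta'
      & (I CSim -> forall l alpha', similar l alpha' alpha ->
          exists2 beta', similar l beta' beta & R alpha' beta') /\
        (I CBack -> forall alpha', path_prefix alpha' alpha ->
          exists2 beta', path_prefix beta' beta & R alpha' beta')].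

Definition bisimulation (S : Type) (I : clause -> Prop) (Y Z : hda S)
    (R : hda_path Y -> hda_path Z -> Prop) : Prop :=
  half_bisimulation I R /\ half_bisimulation I (fun beta alpha => R alpha beta).

Definition bisimilar (S : Type) (I : clause -> Prop) (Y Z : hda S) : Prop :=
  exists R : hda_path Y -> hda_path Z -> Prop, bisimulation I R.

Definition hqhp (c : clause) : Prop := [\/ c = CSub, c = CSim | c = CBack].
Definition hhp (c : clause) : Prop := [\/ c = CSub, c = CSup, c = CSim | c = CBack].

(* Main.v *)
(* Two squares of concurrent events a and b share their lower b-edge and their
   lower a-edge.  On each upper edge sits a square with c, and on exactly one
   of the two upper a-edges, and one of the two upper b-edges, the lower c-edge
   of that square can be followed by d.  This property of an upper edge is seen
   only by a path that ends the first of the events a, b before starting the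
   second, so that it can start c before the second.  The HDAs Y and Z differ in
   how the squares pair up the special upper edges: in Y they belong to the same
   square, in Z to different ones.
   A path of Y that does not run through the end of the lower a-edge sees only
   the upper a-edges, and is matched by exchanging the upper b-edges; a path
   that does not run through the end of the lower b-edge is matched the other
   way round.  Prefixes, similarity and desequentialization never change which
   of the two ends a path runs through, so this is an hqhp-bisimulation.  With
   sequentialization one passes from b+ b- a+ a- over a+ b+ a- b- to
   a+ a- b+ b-, inside one square, and compares the two pairings. *)
Require Import Defs.
From mathcomp Require Import all_boot.
From Stdlib Require Import FunctionalExtensionality ProofIrrelevance.

Set Implicit Arguments.
Unset Strict Implicit.
Unset Printing Implicit Defensive.

(** * Corners of cubes and their images under morphisms of conclists *)

Definition upd (I : eqType) (w : I -> bool) (i : I) (k : bool) : I -> bool :=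
  fun j => if j == i then k else w j.

(* The corner of V that the face f : U -> V identifies with the corner w of U. *)
Definition corner_map (S : Type) (U V : conclist S) (f : hom U V)
    (w : 'I_(dim U) -> bool) : 'I_(dim V) -> bool :=
  fun u => if [pick i | hom_fun f i == u] is Some i then w i
           else odflt false (hom_eps f u).

Section CornerMap.
Variables (S : Type) (U V : conclist S) (f : hom U V).

Lemma corner_map_im w i : corner_map f w (hom_fun f i) = w i.
Proof.
rewrite /corner_map; case: pickP => [j /eqP/hom_inj -> //|/(_ i)].
by rewrite eqxx.
Qed.

Lemma corner_map_eps w u k : hom_eps f u = Some k -> corner_map f w u = k.
Proof.
move=> eps_u; rewrite /corner_map; case: pickP => [i /eqP def_u|_].
  have := hom_star f u; rewrite eps_u -def_u /= => /esym/negP[].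
  exact: codom_f.
by rewrite eps_u.
Qed.

(** Edges in direction [i] go to edges in direction [hom_fun f i]; this is what keeps cubes stable
    under precomposition with [corner_map f]. *)
Lemma corner_map_upd w i k :
  corner_map f (upd w i k) = upd (corner_map f w) (hom_fun f i) k.
Proof.
apply: functional_extensionality => u; rewrite {1}/corner_map /upd.
case: pickP => [j /eqP <-|no_j].
  by rewrite (inj_eq (@hom_inj _ _ _ f)) corner_map_im.
case: eqP => [def_u|_]; first by have := no_j i; rewrite def_u eqxx.
by rewrite /corner_map; case: pickP => [j|//]; rewrite no_j.
Qed.

End CornerMap.

Lemma corner_map_id (S : Type) (U : conclist S) w :
  corner_map (hom_id U) w = w.
Proof.
apply: functional_extensionality => u.
have {1}-> : u = hom_fun (hom_id U) u by rewrite ffunE.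
exact: corner_map_im.
Qed.

(** A coordinate fixed by the composite is fixed by [g] or is the image of one fixed by [f]; a free
    one comes from [U] through both maps. *)
Lemma corner_map_comp (S : Type) (U V W : conclist S)
    (g : hom V W) (f : hom U V) w :
  corner_map (hom_comp g f) w = corner_map g (corner_map f w).
Proof.
apply: functional_extensionality => u.
case eps_u: (hom_eps (hom_comp g f) u) => [k|].
  rewrite (corner_map_eps _ eps_u); move: eps_u; rewrite ffunE.
  case: pickP => [t /eqP <- eps_t|_ eps_u].
    by rewrite corner_map_im (corner_map_eps _ eps_t).
  by rewrite (corner_map_eps _ eps_u).
have /codomP[i def_u] : u \in codom (hom_fun (hom_comp g f)).
  by rewrite -hom_star eps_u.
rewrite def_u corner_map_im.
have -> : hom_fun (hom_comp g f) i = hom_fun g (hom_fun f i) by rewrite ffunE.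
by rewrite !corner_map_im.
Qed.

(* The precubical set of all cubes in a labelled graph; faces are precomposition
   with [corner_map], so that the functor laws are those of [corner_map]. *)
Section GraphCubes.
Variables (S V : Type) (lbl : V -> V -> option S) (v0 : V).

Definition is_cube (U : conclist S) (v : ('I_(dim U) -> bool) -> V) : Prop :=
  forall i w, lbl (v (upd w i false)) (v (upd w i true)) = Some (lab U i).

Definition cube (U : conclist S) : Type :=
  {v : ('I_(dim U) -> bool) -> V | is_cube v}.

Lemma cube_ext U (x y : cube U) : sval x =1 sval y -> x = y.
Proof.
case: x y => v Hv [v' Hv'] /= /functional_extensionality eq_v; subst v'.
by rewrite (proof_irrelevance _ Hv Hv').
Qed.

Lemma cube_map_subproof U W (f : hom U W) (x : cube W) :
  is_cube (fun w => sval x (corner_map f w)).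
Proof.
by move=> i w; rewrite !corner_map_upd (svalP x) hom_lab.
Qed.

Definition cube_map U W (f : hom U W) (x : cube W) : cube U :=
  exist _ _ (cube_map_subproof f x).

Lemma cube_map_id U (x : cube U) : cube_map (hom_id U) x = x.
Proof. by apply: cube_ext => w; rewrite /= corner_map_id. Qed.

Lemma cube_map_comp U W W' (g : hom W W') (f : hom U W) (x : cube W') :
  cube_map (hom_comp g f) x = cube_map f (cube_map g x).
Proof. by apply: cube_ext => w; rewrite /= corner_map_comp. Qed.

Definition cubes : precubical S := Precubical cube_map_id cube_map_comp.

Let pointc : conclist S := Conclist (ffun0 (card_ord 0)).

Lemma point_subproof v : @is_cube pointc (fun=> v).
Proof. by case. Qed.

Definition point v : cell cubes :=
  existT _ pointc (exist _ _ (point_subproof v) : cubes pointc).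

Definition graph_hda : hda S :=
  @Hda S cubes (point v0) erefl.

(** * Cells compared through dimension, labels and corners *)

Implicit Types x y : cell graph_hda.

Definition cdim x : nat := dim (tag x).

(* Corners are addressed by functions on all of nat, so that cells of
   conclists that are not syntactically equal can be compared. *)
Definition cor x (w : nat -> bool) : V :=
  sval (tagged x) (fun i => w (val i)).

Definition src x : V := cor x (fun=> false).
Definition tgt x : V := cor x (fun=> true).

Lemma cor_local x w w' :
  (forall i, i < cdim x -> w i = w' i) -> cor x w = cor x w'.
Proof.
move=> eq_w; rewrite /cor; apply: (congr1 (sval (tagged x))).
by apply: functional_extensionality => i; exact: (eq_w _ (ltn_ord i)).
Qed.

Lemma label_lt x i (lt_i : i < cdim x) :
  label x i = Some (lab (tag x) (Ordinal lt_i)).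
Proof. by rewrite /label (insubT (fun i => i < _) lt_i). Qed.

Lemma label_ge x i : cdim x <= i -> label x i = None.
Proof. by move=> le_i; rewrite /label insubF // ltnNge le_i. Qed.

Lemma cor_edge x i w : i < cdim x ->
  lbl (cor x (upd w i false)) (cor x (upd w i true)) = label x i.
Proof.
move=> lt_i; rewrite (label_lt lt_i).
rewrite -(svalP (tagged x) (Ordinal lt_i) (fun j => w (val j))).
by rewrite /cor; congr lbl; apply: (congr1 (sval (tagged x))).
Qed.

Lemma cell_ext x y : cdim x = cdim y ->
  (forall i, label x i = label y i) -> cor x =1 cor y -> x = y.
Proof.
case: x y => [[n lx] x] [[m ly] y]; rewrite /cdim /= => eq_nm; subst m.
move=> eq_lab eq_cor.
have eq_l : lx = ly.
  apply/ffunP => i; have := eq_lab i.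
  by rewrite /label /= valK => -[].
subst ly; suff -> : x = y by []; apply: cube_ext => w.
(* Extended by [false] beyond [n], the corner [w] becomes an argument of [cor]. *)
have := eq_cor (fun k => if insub k is Some i then w i else false).
rewrite /cor /=.
have -> : (fun i : 'I_n => if insub (val i) is Some j then w j else false) = w.
  by apply: functional_extensionality => i; rewrite valK.
exact: id.
Qed.

Section MakeCell.
Variables (n : nat) (L : nat -> S) (C : (nat -> bool) -> V).
Hypothesis C_local : forall w w', (forall i, i < n -> w i = w' i) -> C w = C w'.
Hypothesis C_edge : forall i w, i < n ->
  lbl (C (upd w i false)) (C (upd w i true)) = Some (L i).

Let U : conclist S := @Conclist S n [ffun i => L (val i)].
Let extend (w : 'I_n -> bool) k := if insub k is Some i then w i else false.

Lemma make_cube_subproof : @is_cube U (fun w => C (extend w)).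
Proof.
move=> i w; rewrite ffunE -(C_edge (extend w) (ltn_ord i)).
by congr lbl; apply: C_local => j lt_j; rewrite /extend /upd insubT.
Qed.

Definition make_cell : cell graph_hda :=
  existT _ U (exist _ _ make_cube_subproof : graph_hda U).

Lemma label_make i : i < n -> label make_cell i = Some (L i).
Proof. by move=> lt_i; rewrite (@label_lt make_cell i lt_i) /= ffunE. Qed.

Lemma cor_make w : cor make_cell w = C w.
Proof.
by apply: C_local => i lt_i; rewrite /extend /= insubT.
Qed.

End MakeCell.

(* The corner of a cell that corresponds to the corner w of its face (i, k). *)
Definition insert_at (i : nat) (k : bool) (w : nat -> bool) : nat -> bool :=
  fun n => if n == i then k else w (unbump i n).

Lemma insert_bump i k w n : insert_at i k w (bump i n) = w n.
Proof. by rewrite /insert_at eq_sym (negPf (neq_bump _ _)) bumpK. Qed.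

Definition face_cell x i (lt_i : i < cdim x) k : cell graph_hda :=
  existT graph_hda _ (face (Ordinal lt_i) k (tagged x)).

Lemma cor_face x i (lt_i : i < cdim x) k w :
  cor (face_cell lt_i k) w = cor x (insert_at i k w).
Proof.
rewrite /cor /=; apply: (congr1 (sval (tagged x))).
apply: functional_extensionality => u.
case: (unliftP (Ordinal lt_i) u) => [j ->|->].
  have {1}-> : lift (Ordinal lt_i) j = hom_fun (coface (Ordinal lt_i) k) j.
    by rewrite ffunE.
  by rewrite corner_map_im /= insert_bump.
rewrite (@corner_map_eps _ _ _ _ _ _ k) ?ffunE ?eqxx //.
by rewrite /insert_at eqxx.
Qed.

Lemma label_face x i (lt_i : i < cdim x) k j :
  label (face_cell lt_i k) j = label x (bump i j).
Proof.
set y := face_cell _ _; have dim_y : cdim y = (cdim x).-1 by [].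
case: (ltnP j (cdim y)) => [lt_j|le_j].
  have lt_b : bump i j < cdim x.
    rewrite -(ltn_predK lt_i) ltnS; apply: leq_trans lt_j.
    by rewrite /bump; case: (i <= j).
  rewrite (label_lt lt_j) (label_lt lt_b) ffunE.
  by congr (Some (lab _ _)); apply: val_inj.
rewrite !label_ge //; move: le_j; rewrite dim_y => le_j.
rewrite -(ltn_predK lt_i) /bump.
have -> : i <= j by rewrite (leq_trans _ le_j) // -ltnS (ltn_predK lt_i).
by rewrite add1n ltnS.
Qed.

(** [is_face] is an equality of dependent pairs; splitting it, by [cell_ext], into dimension, labels
    and corners avoids transport between conclists. *)
Lemma is_faceP i k y x : is_face i k y x <->
  [/\ i < cdim x, cdim y = (cdim x).-1,
      forall j, label y j = label x (bump i j)
    & forall w, cor y w = cor x (insert_at i k w)].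
Proof.
split=> [[lt_i ->]|[lt_i dim_y lab_y cor_y]].
  by split=> // [j|w]; [apply: label_face | apply: cor_face].
exists lt_i; apply: cell_ext => // [j|w].
  by rewrite lab_y -(label_face lt_i k).
by rewrite cor_y -(cor_face lt_i).
Qed.

Lemma src_face i y x : is_face i false y x -> src y = src x.
Proof.
case/is_faceP=> _ _ _ cor_y; rewrite /src cor_y; apply: cor_local => j _.
by rewrite /insert_at; case: ifP.
Qed.

Lemma tgt_face i y x : is_face i true y x -> tgt y = tgt x.
Proof.
case/is_faceP=> _ _ _ cor_y; rewrite /tgt cor_y; apply: cor_local => j _.
by rewrite /insert_at; case: ifP.
Qed.

(** The target of the lower face is the corner of [x] that is 0 at [i] and 1 elsewhere; raising
    coordinate [i] leads to the target of [x]. *)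
Lemma tgt_up i y x : is_face i false y x -> lbl (tgt y) (tgt x) = label x i.
Proof.
case/is_faceP=> lt_i _ _ cor_y.
rewrite -(cor_edge (insert_at i false (fun=> true)) lt_i) /tgt cor_y.
by congr lbl; apply: cor_local => j _;
   rewrite /upd /insert_at; case: (j == i).
Qed.

Lemma src_edge i x : i < cdim x -> exists2 v, lbl (src x) v = label x i & label x i.
Proof.
move=> lt_i; rewrite -(cor_edge (fun=> false) lt_i).
exists (cor x (upd (fun=> false) i true)); last first.
  by rewrite cor_edge // (label_lt lt_i).
by congr (lbl _ _); apply: cor_local => j _; rewrite /upd; case: (j == i).
Qed.

(** * Edges and squares of the graph as cells *)

Section SmallCells.
Variables (u v v' z : V) (l l' : S).
Hypotheses (uv : lbl u v = Some l) (uv' : lbl u v' = Some l')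
  (vz : lbl v z = Some l') (v'z : lbl v' z = Some l).

Definition edge_corner (w : nat -> bool) : V := if w 0 then v else u.

Lemma edge_local w w' :
  (forall i, i < 1 -> w i = w' i) -> edge_corner w = edge_corner w'.
Proof. by move=> eq_w; rewrite /edge_corner !eq_w. Qed.

Lemma edge_edge i w : i < 1 ->
  lbl (edge_corner (upd w i false)) (edge_corner (upd w i true)) = Some l.
Proof. by case: i. Qed.

Definition edge_cell : cell graph_hda := make_cell edge_local edge_edge.

(** Coordinate 0 belongs to the event [l], coordinate 1 to [l']; this fixes the indices of the moves
    around a square. *)
Definition square_corner (w : nat -> bool) : V :=
  if w 0 then (if w 1 then z else v) else (if w 1 then v' else u).

Lemma square_local w w' :
  (forall i, i < 2 -> w i = w' i) -> square_corner w = square_corner w'.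
Proof. by move=> eq_w; rewrite /square_corner !eq_w. Qed.

Lemma square_edge i w : i < 2 ->
  lbl (square_corner (upd w i false)) (square_corner (upd w i true))
  = Some (if i == 0 then l else l').
Proof.
by case: i => [|[|i]] //= _; rewrite /square_corner /upd /=; case: (w _).
Qed.

Definition square_cell : cell graph_hda := make_cell square_local square_edge.

Lemma face_edge k :
  is_face 0 k (point (if k then v else u) : cell graph_hda) edge_cell.
Proof.
apply/is_faceP; split=> // [j|w]; first by rewrite !label_ge.
by rewrite cor_make /edge_corner /insert_at /=; case: k.
Qed.

End SmallCells.

Lemma face_square0 k u v v' z l l' uv uv' vz v'z e :
  is_face 0 k (@edge_cell (if k then v else u) (if k then z else v') l' e)
    (@square_cell u v v' z l l' uv uv' vz v'z).
Proof.
apply/is_faceP; split=> // [[|j]|w]; first by rewrite !label_make.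
  by rewrite !label_ge.
rewrite !cor_make /edge_corner /square_corner /insert_at /=.
by case: k {e}.
Qed.

Lemma face_square1 k u v v' z l l' uv uv' vz v'z e :
  is_face 1 k (@edge_cell (if k then v' else u) (if k then z else v) l e)
    (@square_cell u v v' z l l' uv uv' vz v'z).
Proof.
apply/is_faceP; split=> // [[|j]|w]; first by rewrite !label_make.
  by rewrite !label_ge.
rewrite !cor_make /edge_corner /square_corner /insert_at /=.
by case: k {e}; case: (w _).
Qed.

(* By [tgt_up] and [tgt_face], the target of a cell of a path runs through the
   graph along the started events, and only along these. *)
Fixpoint run (u : V) (s : seq (option S)) (v : V) : Prop :=
  if s is o :: s' then exists2 u', lbl u u' = o & run u' s' v else u = v.

End GraphCubes.

Arguments graph_hda {S V}.

(** * Paths and the events they start *)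

Section Paths.
Variables (S : Type) (X : hda S).
Implicit Types (s : seq (move * cell X)) (x y : cell X).

Definition endpoint x s : cell X := last x (map snd s).

Lemma endpoint_cat x s1 s2 : endpoint x (s1 ++ s2) = endpoint (endpoint x s1) s2.
Proof. by rewrite /endpoint map_cat last_cat. Qed.

Lemma is_path_cat x s1 s2 :
  is_path x (s1 ++ s2) <-> is_path x s1 /\ is_path (endpoint x s1) s2.
Proof.
elim: s1 x => [|[phi y] s1 IHs] x /=; first by split=> [|[]].
by split=> [[? /IHs[]]|[[? ?] ?]]; split=> //; apply/IHs.
Qed.

Definition started s : seq (option S) :=
  pmap (fun p => if p is (up i, y) then Some (label y i) else None) s.

Definition ST_started (T : seq (ST_letter (option S))) : seq (option S) :=
  pmap (fun z => if z is ST_start o then Some o else None) T.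

Lemma ST_startedE past x s : ST_started (ST_from past x s) = started s.
Proof. by elim: s past x => [|[[i|i] y] s IHs] past x //=; rewrite IHs. Qed.

End Paths.

Lemma run_path (S V : Type) (lbl : V -> V -> option S) v0
    (x : cell (graph_hda lbl v0)) s :
  is_path x s -> run lbl (tgt x) (started s) (tgt (endpoint x s)).
Proof.
elim: s x => [|[phi y] s IHs] x //= [step_xy /IHs]; case: phi step_xy => i /=.
  by move=> face_xy run_y; exists (tgt y) => //; apply: tgt_up.
by move=> face_xy; rewrite -(tgt_face face_xy).
Qed.

(** * The graph of the example and its flips *)

Inductive vertex :=
  origin | side of bool | top of bool | top' of bool
| off of bool & bool | dead of bool.

(* Each [top i] is the far corner of one square of a and b, and [off m i] is the
   end of a c-edge from [side m], which d can follow only if i = true.  The twist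
   t decides whether the c-edge to [off true i] lies opposite the one at
   [top i] or at [top (~~ i)]. *)
Section Example.
Variables (S : Type) (a b c d : S).
Hypotheses (ab : a <> b) (ac : a <> c) (ad : a <> d)
  (bc : b <> c) (bd : b <> d).

Definition act_of (m : bool) : S := if m then a else b.

Definition edge (t : bool) (u v : vertex) : option S :=
  match u, v with
  | origin, side m => Some (act_of m)
  | side m, top _ => Some (act_of (~~ m))
  | side m, off m' _ => if m == m' then Some c else None
  | top i, top' j => if i == j then Some c else None
  | off m i, top' j => if j == i (+) (m && t) then Some (act_of (~~ m)) else None
  | off m i, dead m' => if i && (m == m') then Some d else None
  | _, _ => None
  end.

Definition twisted t : hda S := graph_hda (edge t) origin.

Definition flip (m : bool) (v : vertex) : vertex :=
  match v with
  | top i => top (i (+) ~~ m)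
  | top' i => top' (i (+) ~~ m)
  | off m' i => off m' (i (+) (m == m'))
  | _ => v
  end.

Lemma flipK m : involutive (flip m).
Proof. by case: m => -[|m'|[]|[]|[] []|m']. Qed.

(** Changing the twist reverses how the vertices [off true i] are attached to the [top' j].
    [flip true] compensates by exchanging the former, [flip false] by exchanging the [top], the
    [top'] and the [off false i]. Either way only the [d]-edge into [dead m] is broken. *)
Lemma edge_flip t m u v :
  v <> dead m -> edge (~~ t) (flip m u) (flip m v) = edge t u v.
Proof.
by case: t m u v => [] [] [|[]|[]|[]|[] []|[]] [|[]|[]|[]|[] []|[]] //= [].
Qed.

(* The cells x met on paths that avoid the vertex [side m]; on them [flip m]
   preserves the graph. *)
Definition flippable t (m : bool) (x : cell (twisted t)) : Prop :=
  match tgt x with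
  | origin => cdim x = 0
  | side m' => m' = m -> cdim x = 1 /\ src x = origin
  | off m' _ => m' <> m
  | dead m' => m' <> m
  | _ => True
  end.

(** A flippable cell with target [side m] is the edge from [origin]. Ending its event gives the
    excluded vertex, and [c] cannot start during it, so [off m] and [dead m] stay out of reach. *)
Lemma flippable_step t m (x y : cell (twisted t)) phi :
  is_step x phi y -> flippable m x -> ~ (cdim y = 0 /\ tgt y = side m) ->
  flippable m y.
Proof.
case: phi => i /= face_xy; rewrite /flippable.
  have := tgt_up face_xy; have := src_face face_xy.
  case/is_faceP: face_xy => lt_i dim_x _ _.
  case: (src_edge lt_i) => v.
  have src_tgt : cdim x = 0 -> src x = tgt x.
    by move=> dim0; apply: cor_local; rewrite dim0.
  move=> src_e lab_y src_xy tgt_e; rewrite -tgt_e in src_e lab_y.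
  move: src_tgt.
  case def_x: (tgt x) tgt_e src_e lab_y => [|m1|i1|i1|m1 i1|m1];
  case: (tgt y) => [|m2|i2|i2|m2 i2|m2] //= tgt_e src_e lab_y src_tgt.
  - move=> dim0 _ _; rewrite -src_xy src_tgt //; split=> //.
    by move: lt_i dim_x; rewrite dim0; case: (cdim y) => // -[].
  (* Were [m1 = m], the event [c] of [y] would give a [c]-edge out of the source [origin], where
     only [a] and [b] start. *)
  - case: eqP lab_y tgt_e src_e => // -> _ _ src_e sideP _ def_m.
    have [_ src_O] := sideP def_m; rewrite -src_xy src_O in src_e.
    by case: v src_e => // -[] /= [].
  - by case: eqP lab_y; rewrite ?andbF // andbT; case: ifP => // _ ->.
move=> + not_side; have tgt_xy := tgt_face face_xy; rewrite tgt_xy.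
case/is_faceP: face_xy => lt_i dim_y _ _.
case def_x: (tgt x) => [|m1|i1|i1|m1 i1|m1] //.
  by move=> dim0; rewrite dim0 in lt_i.
move=> sideP /[dup] def_m /sideP[dim1 _].
by case: not_side; rewrite dim_y dim1 tgt_xy def_x def_m.
Qed.

(** No edge leaves [dead m], so only the target of a cell can be this vertex. *)
Lemma flippable_not_dead t m (x : cell (twisted t)) w :
  flippable m x -> cor x w <> dead m.
Proof.
move=> flip_x dead_w.
case: (boolP [exists j : 'I_(cdim x), ~~ w j]) => [/existsP[j /negPf wj]|].
  have := cor_edge w (ltn_ord j); rewrite (label_lt (ltn_ord j)).
  have -> : cor x (upd w j false) = cor x w.
    by apply: cor_local => k _; rewrite /upd; case: eqP => // ->.
  by rewrite dead_w.
move/existsPn => allw; move: flip_x; rewrite /flippable.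
have -> : tgt x = cor x w.
  by apply: cor_local => k lt_k; have /negbNE := allw (Ordinal lt_k).
by rewrite dead_w; apply.
Qed.

(** * Flipping cells and paths *)

Definition flipped t t' m (x : cell (twisted t)) (y : cell (twisted t')) : Prop :=
  [/\ cdim y = cdim x, forall i, label y i = label x i,
      forall w, cor y w = flip m (cor x w) & flippable m x].

(** Flipping all corners preserves the labels by [edge_flip], as none of them is [dead m]. The
    default [a] in [L] only concerns positions outside [x]. *)
Lemma flipped_ex t t' m (x : cell (twisted t)) :
  t' = ~~ t -> flippable m x -> exists y, @flipped t t' m x y.
Proof.
move=> -> flip_x; pose L i := odflt a (label x i); pose C w := flip m (cor x w).
have C_local w w' : (forall i, i < cdim x -> w i = w' i) -> C w = C w'.
  by move=> eq_w; rewrite /C (cor_local eq_w).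
have C_edge i w : i < cdim x ->
    edge (~~ t) (C (upd w i false)) (C (upd w i true)) = Some (L i).
  move=> lt_i; rewrite edge_flip; last exact: flippable_not_dead.
  by rewrite [edge _ _ _](cor_edge w lt_i) /L (label_lt lt_i).
exists (make_cell origin C_local C_edge); split=> // [i|w]; last exact: cor_make.
case: (ltnP i (cdim x)) => [lt_i|le_i]; last by rewrite !label_ge.
by rewrite label_make // /L (label_lt lt_i).
Qed.

Lemma flipped_step t t' m phi (x x' : cell (twisted t)) (y y' : cell (twisted t')) :
  flipped m x y -> flipped m x' y' -> is_step x phi x' -> is_step y phi y'.
Proof.
move=> [dx lx cx _] [dx' lx' cx' _].
by case: phi => i /= /is_faceP[lt_i dy ly cy]; apply/is_faceP;
   split; rewrite ?dx ?dx' // => *; rewrite ?lx ?lx' ?cx ?cx' ?ly ?cy.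
Qed.

Lemma flipped_sym t t' m (x : cell (twisted t)) (y : cell (twisted t')) :
  flipped m x y -> flipped m y x.
Proof.
move=> [dx lx cx flip_x]; split=> // [w|]; first by rewrite cx flipK.
move: flip_x; rewrite /flippable /tgt /src !cx dx.
by case: (cor x (fun=> true)) => //= m' h /h[-> ->].
Qed.

Fixpoint flipped_seq t t' m (s : seq (move * cell (twisted t)))
    (s' : seq (move * cell (twisted t'))) : Prop :=
  match s, s' with
  | [::], [::] => True
  | (phi, x) :: s1, (psi, y) :: s1' =>
      [/\ phi = psi, flipped m x y & flipped_seq m s1 s1']
  | _, _ => False
  end.

Lemma flipped_seq_sym t t' m (s : seq (move * cell (twisted t)))
    (s' : seq (move * cell (twisted t'))) :
  flipped_seq m s s' -> flipped_seq m s' s.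
Proof.
elim: s s' => [|[phi x] s IHs] [|[psi y] s'] //= [-> xy /IHs ss'].
by split=> //; apply: flipped_sym.
Qed.

Lemma flipped_seq_cat t t' m (s1 s2 : seq (move * cell (twisted t)))
    (s1' s2' : seq (move * cell (twisted t'))) :
  flipped_seq m s1 s1' -> flipped_seq m s2 s2' ->
  flipped_seq m (s1 ++ s2) (s1' ++ s2').
Proof.
elim: s1 s1' => [|[phi x] s1 IHs] [|[psi y] s1'] //= [-> xy ss'] ss2.
by split=> //; apply: IHs.
Qed.

Lemma flipped_seq_catl t t' m (s1 s2 : seq (move * cell (twisted t)))
    (s' : seq (move * cell (twisted t'))) :
  flipped_seq m (s1 ++ s2) s' -> exists s1' s2',
    [/\ s' = s1' ++ s2', flipped_seq m s1 s1' & flipped_seq m s2 s2'].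
Proof.
elim: s1 s' => [|[phi x] s1 IHs] s' /=; first by exists [::], s'.
case: s' => // -[psi y] s' [<- xy /IHs[s1' [s2' [-> ss1 ss2]]]].
by exists ((phi, y) :: s1'), s2'.
Qed.

Lemma flipped_endpoint t t' m (x : cell (twisted t)) (y : cell (twisted t')) s s' :
  flipped m x y -> flipped_seq m s s' ->
  flipped m (endpoint x s) (endpoint y s').
Proof.
elim: s s' x y => [|[phi x'] s IHs] [|[psi y'] s'] //= x y _ [_ xy' /IHs]; exact.
Qed.

Lemma flipped_path t t' m (x : cell (twisted t)) (y : cell (twisted t')) s s' :
  flipped m x y -> flipped_seq m s s' -> is_path x s -> is_path y s'.
Proof.
elim: s s' x y => [|[phi x'] s IHs] [|[psi y'] s'] //= x y xy [<- xy' ss'].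
move=> [step_x path_s]; split; last exact: IHs ss' path_s.
exact: flipped_step xy xy' step_x.
Qed.

Lemma flipped_ST_from t t' m past (x : cell (twisted t)) (y : cell (twisted t')) s s' :
  flipped m x y -> flipped_seq m s s' -> ST_from past x s = ST_from past y s'.
Proof.
elim: s s' past x y => [|[phi x'] s IHs] [|[psi y'] s'] //= past x y xy [<- xy' ss'].
rewrite (IHs _ _ _ _ xy' ss'); case: phi => i; congr (_ :: _).
  by case: xy' => _ -> _ _.
by case: xy => _ -> _ _.
Qed.

(** * The hqhp-bisimulation *)

Lemma flipped_init t t' m : flipped m (init (twisted t)) (init (twisted t')).
Proof. by split. Qed.

(** One [m] serves a whole pair of paths, but it is not recorded: extending the pair may require the
    other one. *)
Definition flip_related t t' (alpha : hda_path (twisted t))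
    (beta : hda_path (twisted t')) : Prop :=
  exists m, flipped_seq m (steps alpha) (steps beta).

Lemma flip_related_sym t t' (alpha : hda_path (twisted t))
    (beta : hda_path (twisted t')) :
  flip_related alpha beta -> flip_related beta alpha.
Proof. by case=> m /flipped_seq_sym; exists m. Qed.

Lemma replacedC (X : hda S) (rule : move * move -> move * move -> Prop) l
    (alpha beta : hda_path X) :
  replaced rule l alpha beta -> replaced (fun p q => rule q p) l beta alpha.
Proof.
case=> [s [u [phi [psi [phi' [psi' [x [x' [y H]]]]]]]]]; case: H => *.
by exists s, u, phi', psi', phi, psi, x', x, y.
Qed.

(** The hypothesis on [rule] says that the new steps are not a down-step followed by an up-step. So
    the new middle cell has positive dimension and is not the vertex [side m]. Sequentialization
    fails exactly this test. *)
Lemma flipped_replaced t t' m (rule : move * move -> move * move -> Prop) l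
    (alpha alpha' : hda_path (twisted t)) (beta : hda_path (twisted t')) :
  t' = ~~ t ->
  (forall p phi psi, rule p (phi, psi) ->
     (if phi is up _ then true else false)
     || (if psi is down _ then true else false)) ->
  flipped_seq m (steps alpha) (steps beta) -> replaced rule l alpha alpha' ->
  exists2 beta', replaced rule l beta beta' &
    flipped_seq m (steps alpha') (steps beta').
Proof.
move=> def_t' ruleP.
move=> + [s [u [phi [psi [phi' [psi' [x [x' [y [size_s rule_l def_a def_a']]]]]]]]]].
rewrite def_a => /flipped_seq_catl[s1 [s2 [def_b ss1 ss2]]].
case: s2 ss2 def_b => [|[psi1 x1] [|[psi2 y1] u1]] //= [] //.
move=> <- xx1 [<- yy1 uu1] def_b.
have := stepsP alpha'; have := stepsP alpha; rewrite def_a def_a'.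
case/is_path_cat => path_s [step_x [step_y path_u]].
case/is_path_cat => _ [step_x' [step_y' _]].
have end_s := flipped_endpoint (flipped_init t t' m) ss1.
have [_ _ _ flip_end] := end_s.
have /(flipped_ex def_t')[x1' xx1'] : flippable m x'.
  apply: (flippable_step step_x' flip_end) => -[dim0 _].
  have := ruleP _ _ _ rule_l.
  case: (phi') step_x' => i /=.
    by move=> /is_faceP[]; rewrite dim0.
  case: (psi') step_y' => // j /= /is_faceP[]; by rewrite dim0.
have path_b : is_path (init (twisted t')) (s1 ++ (phi', x1') :: (psi', y1) :: u1).
  apply: (flipped_path (flipped_init t t' m) (s := steps alpha'));
    last exact: stepsP.
  by rewrite def_a'; apply: flipped_seq_cat.
exists (HdaPath path_b); last by apply: flipped_seq_cat.
exists s1, u1, phi, psi, phi', psi', x1, x1', y1; split=> //.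
rewrite -size_s; congr _.+1.
by elim: (s) (s1) ss1 => [|[? ?] ? IHs] [|[? ?] ?] //= [_ _ /IHs ->].
Qed.

Definition near_side m (x : vertex) : Prop := x = origin \/ x = side m.

(** Both flips fix [origin] and [side m], and flippability leaves [x] no other corners when its
    target is one of these. *)
Lemma flipped_switch t t' m (x : cell (twisted t)) (y : cell (twisted t')) :
  flipped m x y -> near_side m (tgt x) -> flipped (~~ m) x y.
Proof.
move=> [dx lx cx flip_x] near_x; split=> // [w|]; last first.
  by move: flip_x; rewrite /flippable; case: near_x => -> //= _; case: (m).
rewrite cx; suff [->|->] : cor x w = origin \/ cor x w = side m by [].
move: flip_x; rewrite /flippable; case: near_x => def_x; rewrite def_x.
  by move=> dim0; left; rewrite -[RHS]def_x; apply: cor_local; rewrite dim0.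
move=> /(_ erefl)[dim1 src_x]; case def_w: (w 0); [right|left].
  by rewrite -def_x; apply: cor_local; rewrite dim1 => -[].
by rewrite -[RHS]src_x; apply: cor_local; rewrite dim1 => -[].
Qed.

(** Only [origin] has an edge into [side m], and nothing leads into [origin]; so the endpoint of a
    path decides for all its cells. *)
Lemma near_side_step t m (x y : cell (twisted t)) phi :
  is_step x phi y -> near_side m (tgt y) -> near_side m (tgt x).
Proof.
case: phi => i /=; last by move=> face_yx; rewrite (tgt_face face_yx).
move=> face_xy; have := tgt_up face_xy.
have [lt_i _ _ _] := (is_faceP _ _ _ _).1 face_xy; rewrite (label_lt lt_i).
by move=> + [def_y|def_y]; rewrite def_y; case: (tgt x) => //=; left.
Qed.

Lemma flipped_seq_switch t t' m (x : cell (twisted t))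
    (s : seq (move * cell (twisted t))) (s' : seq (move * cell (twisted t'))) :
  is_path x s -> near_side m (tgt (endpoint x s)) -> flipped_seq m s s' ->
  flipped_seq (~~ m) s s' /\ near_side m (tgt x).
Proof.
elim: s s' x => [|[phi y] s IHs] [|[psi y'] s'] //= x [step_x path_s] near_end.
case=> <- yy' ss'; have [ss'' near_y] := IHs _ _ path_s near_end ss'.
split; last exact: near_side_step step_x near_y.
by split=> //; apply: flipped_switch.
Qed.

(* The choice of m only becomes wrong when a path reaches the vertex [side m];
   up to there [flip m] and [flip (~~ m)] agree. *)
Lemma flipped_extend1 t t' (s : seq (move * cell (twisted t)))
    (s' : seq (move * cell (twisted t'))) z :
  t' = ~~ t -> (exists m, flipped_seq m s s') ->
  is_path (init (twisted t)) (rcons s z) ->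
  exists z', exists m, flipped_seq m (rcons s z) (rcons s' z').
Proof.
move=> def_t' [m ss']; case: z => phi y; rewrite -cats1 => /is_path_cat[path_s].
move=> [/= step_y _].
have extend n : flipped_seq n s s' -> ~ (cdim y = 0 /\ tgt y = side n) ->
    exists z', exists m, flipped_seq m (s ++ [:: (phi, y)]) (rcons s' z').
  move=> nss' not_side.
  have [_ _ _ flip_end] := flipped_endpoint (flipped_init t t' n) nss'.
  have [y' yy'] := flipped_ex def_t' (flippable_step step_y flip_end not_side).
  exists (phi, y'), n; rewrite -cats1.
  by apply: flipped_seq_cat => //=; split.
case: (boolP ((cdim y == 0) && (if tgt y is side n then n == m else false))).
  case/andP=> /eqP dim0; case def_y: (tgt y) => [|n||||] // /eqP def_n.
  (* The path enters the vertex [side m]: the pairing so far is read again with [~~ m], for which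
     this vertex is harmless. *)
  rewrite def_n in def_y; apply: (extend (~~ m)); last first.
    by rewrite def_y => -[_ []]; case: (m).
  have near_y : near_side m (tgt y) by right.
  by case: (flipped_seq_switch path_s (near_side_step step_y near_y) ss').
move=> not_side; apply: (extend m) => // -[dim0 def_y].
by move: not_side; rewrite dim0 def_y !eqxx.
Qed.

Lemma flipped_extend t t' (s1 s2 : seq (move * cell (twisted t)))
    (s1' : seq (move * cell (twisted t'))) :
  t' = ~~ t -> (exists m, flipped_seq m s1 s1') ->
  is_path (init (twisted t)) (s1 ++ s2) ->
  exists s2', exists m, flipped_seq m (s1 ++ s2) (s1' ++ s2').
Proof.
move=> def_t'; elim: s2 s1 s1' => [|z s2 IHs] s1 s1' ss1.
  by move=> _; exists [::]; rewrite !cats0.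
rewrite -cat_rcons => path_s; have [path1 _] := (is_path_cat _ _ _).1 path_s.
have [z' ss'] := flipped_extend1 def_t' ss1 path1.
have [s2' ss2] := IHs _ _ ss' path_s.
by exists (z' :: s2'); rewrite -cat_rcons.
Qed.

Lemma flip_related_half t t' :
  t' = ~~ t -> half_bisimulation hqhp (@flip_related t t').
Proof.
move=> def_t'; split; first by exists true.
move=> alpha beta [m ab_m]; split.
- exact: flipped_ST_from (flipped_init t t' m) ab_m.
- move=> alpha' [s def_a']; have := stepsP alpha'; rewrite def_a' => path_s.
  have [s' [n ss']] := flipped_extend def_t' (ex_intro _ m ab_m) path_s.
  have path_s' := flipped_path (flipped_init t t' n) ss' path_s.
  by exists (HdaPath path_s'); [exists s' | exists n; rewrite def_a'].
- move=> _ l alpha' /replacedC/(flipped_replaced def_t' _ ab_m)[] => [p phi psi|].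
    by move=> H; inversion H.
  by move=> beta' /replacedC repl ab'; exists beta' => //; exists m.
- by case.
split=> [_ l alpha'|_ alpha' [s def_a]].
  case=> [/replacedC|] /(flipped_replaced def_t' _ ab_m)[] =>
    [p phi psi||p phi psi|]; try by move=> H; inversion H.
  - by move=> beta' /replacedC repl ab'; exists beta'; [left | exists m].
  - by move=> beta' repl ab'; exists beta'; [right | exists m].
move: ab_m; rewrite def_a => /flipped_seq_catl[s1 [s2 [def_b ss1 _]]].
have path_s1 := flipped_path (flipped_init t t' m) ss1 (stepsP alpha').
by exists (HdaPath path_s1); [exists s2 | exists m].
Qed.

Lemma twisted_hqhp : bisimilar hqhp (twisted false) (twisted true).
Proof.
exists (@flip_related false true); split; first exact: flip_related_half.
(* Flips are involutive, so the converse relation is the same one with the twists exchanged. *)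
have [init_r half_r] := @flip_related_half true false erefl.
split=> [|beta alpha]; first exact: flip_related_sym init_r.
move=> /flip_related_sym /half_r[st ext sub sup [sim back]]; split=> //.
- by move=> ? /ext[? ? /flip_related_sym]; eexists; eauto.
- by move=> I l ? /(sub I)[? ? /flip_related_sym]; eexists; eauto.
- by move=> I l ? /(sup I)[? ? /flip_related_sym]; eexists; eauto.
split.
- by move=> I l ? /(sim I)[? ? /flip_related_sym]; eexists; eauto.
- by move=> I ? /(back I)[? ? /flip_related_sym]; eexists; eauto.
Qed.


(** * What an hhp-bisimulation preserves about final vertices *)

Definition final t (alpha : hda_path (twisted t)) : vertex :=
  tgt (endpoint (init (twisted t)) (steps alpha)).

Lemma run_prefix t (alpha beta : hda_path (twisted t)) w :
  path_prefix alpha beta -> started (steps beta) = started (steps alpha) ++ w ->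
  run (edge t) (final alpha) w (final beta).
Proof.
case=> s def_b; have := stepsP beta; rewrite /final def_b => /is_path_cat[_ path_s].
rewrite endpoint_cat /started pmap_cat => eq_w.
have <- : started s = w.
  by move/(congr1 (drop (size (started (steps alpha))))): eq_w; rewrite !drop_size_cat.
exact: run_path path_s.
Qed.

(** A replacement changes an inner cell only, never the last one. *)
Lemma final_replaced t rule l (alpha beta : hda_path (twisted t)) :
  replaced rule l alpha beta -> final alpha = final beta.
Proof.
case=> [s [u [phi [psi [phi' [psi' [x [x' [y []]]]]]]]]] _ _ def_a def_b.
by rewrite /final def_a def_b !endpoint_cat.
Qed.

(** Equal ST-traces force equal sequences of started labels, so the extension of [beta] follows
    edges labelled [w] as well. *)
Lemma hhp_forth t t' (R : hda_path (twisted t) -> hda_path (twisted t') -> Prop)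
    alpha beta alpha' w :
  half_bisimulation hhp R -> R alpha beta -> path_prefix alpha alpha' ->
  started (steps alpha') = started (steps alpha) ++ w ->
  exists beta', [/\ R alpha' beta', path_prefix beta beta'
                  & run (edge t') (final beta) w (final beta')].
Proof.
move=> [_ half_R] Rab ext started_w.
have [ST_ab /(_ _ ext)[beta' ext' Rab'] _ _ _] := half_R _ _ Rab.
have [ST_ab' _ _ _ _] := half_R _ _ Rab'.
exists beta'; split=> //; apply: run_prefix => //.
move: (congr1 (@ST_started _) ST_ab) (congr1 (@ST_started _) ST_ab').
by rewrite /ST !ST_startedE => <- <-.
Qed.

Lemma hhp_back t t' (R : hda_path (twisted t) -> hda_path (twisted t') -> Prop)
    alpha beta alpha' w :
  half_bisimulation hhp R -> R alpha beta -> path_prefix alpha' alpha ->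
  started (steps alpha) = started (steps alpha') ++ w ->
  exists beta', [/\ R alpha' beta', path_prefix beta' beta
                  & run (edge t') (final beta') w (final beta)].
Proof.
move=> [_ half_R] Rab ext started_w.
have [ST_ab _ _ _ [_ back]] := half_R _ _ Rab.
have [|beta' ext' Rab'] := back _ _ ext; first exact: Or44.
have [ST_ab' _ _ _ _] := half_R _ _ Rab'.
exists beta'; split=> //; apply: run_prefix => //.
move: (congr1 (@ST_started _) ST_ab) (congr1 (@ST_started _) ST_ab').
by rewrite /ST !ST_startedE => <- <-.
Qed.

Lemma hhp_sim t t' (R : hda_path (twisted t) -> hda_path (twisted t') -> Prop)
    alpha beta alpha' l :
  half_bisimulation hhp R -> R alpha beta -> similar l alpha' alpha ->
  exists2 beta', R alpha' beta' & final beta' = final beta.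
Proof.
move=> [_ half_R] Rab; have [_ _ _ _ [sim _]] := half_R _ _ Rab.
move=> /(sim (Or43 _ _ _ erefl))[beta' sim' Rab']; exists beta' => //.
by case: sim' => /final_replaced.
Qed.

Lemma hhp_sub t t' (R : hda_path (twisted t) -> hda_path (twisted t') -> Prop)
    alpha beta alpha' l :
  half_bisimulation hhp R -> R alpha beta -> subsumed l alpha alpha' ->
  exists2 beta', R alpha' beta' & final beta' = final beta.
Proof.
move=> [_ half_R] Rab; have [_ _ sub _ _] := half_R _ _ Rab.
move=> /(sub (Or41 _ _ _ erefl))[beta' sub' Rab']; exists beta' => //.
exact: final_replaced sub'.
Qed.

Lemma hhp_sup t t' (R : hda_path (twisted t) -> hda_path (twisted t') -> Prop)
    alpha beta alpha' l :
  half_bisimulation hhp R -> R alpha beta -> subsumed l alpha' alpha ->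
  exists2 beta', R alpha' beta' & final beta' = final beta.
Proof.
move=> [_ half_R] Rab; have [_ _ _ sup _] := half_R _ _ Rab.
move=> /(sup (Or42 _ _ _ erefl))[beta' sup' Rab']; exists beta' => //.
by symmetry; exact: final_replaced sup'.
Qed.

(** * Test cells and test paths in [twisted false] *)

Lemma edge_side m : edge false origin (side m) = Some (act_of m).
Proof. by []. Qed.

Lemma edge_top m : edge false (side m) (top true) = Some (act_of (~~ m)).
Proof. by []. Qed.

Lemma edge_off m : edge false (side m) (off m true) = Some c.
Proof. by case: m. Qed.

Lemma edge_top' : edge false (top true) (top' true) = Some c.
Proof. by []. Qed.

Lemma edge_off_top' m : edge false (off m true) (top' true) = Some (act_of (~~ m)).
Proof. by case: m. Qed.

Lemma edge_dead m : edge false (off m true) (dead m) = Some d.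
Proof. by case: m. Qed.

Let arrow u v l (e : edge false u v = Some l) : cell (twisted false) :=
  edge_cell origin e.
Let vtx u : cell (twisted false) := point (edge false) u.
(** Here [b] is event 0 and [a] event 1; in [square_c m] below, [act_of (~~ m)] is event 0 and [c]
    event 1. *)
Let square_ab : cell (twisted false) :=
  square_cell origin (edge_side false) (edge_side true) (edge_top false) (edge_top true).
Let square_c m : cell (twisted false) :=
  square_cell origin (edge_top m) (edge_off m) edge_top' (edge_off_top' m).

Definition via_side m : seq (move * cell (twisted false)) :=
  [:: (up 0, arrow (edge_side m)); (down 0, vtx (side m));
      (up 0, arrow (edge_top m))].

Definition via_off m : seq (move * cell (twisted false)) :=
  [:: (up 0, arrow (edge_side m)); (down 0, vtx (side m));
      (up 0, arrow (edge_off m))].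

Lemma arrow_up u v l (e : edge false u v = Some l) : is_step (vtx u) (up 0) (arrow e).
Proof. exact: (face_edge origin e false). Qed.

Lemma arrow_down u v l (e : edge false u v = Some l) : is_step (arrow e) (down 0) (vtx v).
Proof. exact: (face_edge origin e true). Qed.

Lemma via_side_path m : is_path (init (twisted false)) (via_side m).
Proof. by split; [exact: arrow_up | split; [exact: arrow_down | split; [exact: arrow_up|]]]. Qed.

Lemma via_side_square_path m :
  is_path (init (twisted false)) (via_side m ++ [:: (up 1, square_c m)]).
Proof.
split; [exact: arrow_up | split; [exact: arrow_down | split; [exact: arrow_up|]]].
by split=> //; exact: (face_square1 origin (k := false)).
Qed.

Lemma via_off_square_path m :
  is_path (init (twisted false)) (via_off m ++ [:: (up 0, square_c m)]).
Proof.
split; [exact: arrow_up | split; [exact: arrow_down | split; [exact: arrow_up|]]].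
by split=> //; exact: (face_square0 origin (k := false)).
Qed.

Lemma via_off_path m : is_path (init (twisted false)) (via_off m).
Proof. by split; [exact: arrow_up | split; [exact: arrow_down | split; [exact: arrow_up|]]]. Qed.

Lemma via_off_dead_path m : is_path (init (twisted false))
  (via_off m ++ [:: (down 0, vtx (off m true)); (up 0, arrow (edge_dead m))]).
Proof.
split; [exact: arrow_up | split; [exact: arrow_down | split; [exact: arrow_up|]]].
by split; [exact: arrow_down | split; [exact: arrow_up|]].
Qed.

Lemma via_side_top_path m :
  is_path (init (twisted false)) (via_side m ++ [:: (down 0, vtx (top true))]).
Proof.
split; [exact: arrow_up | split; [exact: arrow_down | split; [exact: arrow_up|]]].
by split=> //; exact: arrow_down.
Qed.

(** In these names the first pair of letters is the order of the starts, the second that of the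
    ends. *)
Lemma overlap_path_ba_ba : is_path (init (twisted false))
  [:: (up 0, arrow (edge_side false)); (up 1, square_ab);
      (down 0, arrow (edge_top false)); (down 0, vtx (top true))].
Proof.
split; [exact: arrow_up | split; [exact: (face_square1 origin (k := false)) |]].
split; [exact: (face_square0 origin (k := true)) | split=> //; exact: arrow_down].
Qed.

Lemma overlap_path_ba_ab : is_path (init (twisted false))
  [:: (up 0, arrow (edge_side false)); (up 1, square_ab);
      (down 1, arrow (edge_top true)); (down 0, vtx (top true))].
Proof.
split; [exact: arrow_up | split; [exact: (face_square1 origin (k := false)) |]].
split; [exact: (face_square1 origin (k := true)) | split=> //; exact: arrow_down].
Qed.

Lemma overlap_path_ab_ab : is_path (init (twisted false))
  [:: (up 0, arrow (edge_side true)); (up 0, square_ab);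
      (down 1, arrow (edge_top true)); (down 0, vtx (top true))].
Proof.
split; [exact: arrow_up | split; [exact: (face_square0 origin (k := false)) |]].
split; [exact: (face_square1 origin (k := true)) | split=> //; exact: arrow_down].
Qed.

Lemma hhp_init t t' (R : hda_path (twisted t) -> hda_path (twisted t') -> Prop)
    alpha beta :
  half_bisimulation hhp R -> R alpha beta ->
  run (edge t') origin (started (steps alpha)) (final beta).
Proof.
move=> [_ half_R] /half_R[ST_ab _ _ _ _].
have := congr1 (@ST_started _) ST_ab; rewrite /ST !ST_startedE => ->.
exact: run_path (stepsP beta).
Qed.

(** The test starts [c], swaps the last two starts, withdraws that of [act_of (~~ m)], ends [c] and
    starts [d]. The partner can follow only from [off m true], which the twist attaches to
    [top' (~~ m)], the end of the [c]-edge from [top (~~ m)]. *)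
Lemma final_via_side (R : hda_path (twisted false) -> hda_path (twisted true) -> Prop)
    m alpha beta :
  half_bisimulation hhp R -> R alpha beta -> steps alpha = via_side m ->
  final beta = top (~~ m).
Proof.
move=> half_R Rab def_a.
pose alpha2 := HdaPath (via_side_square_path m).
pose alpha3 := HdaPath (via_off_square_path m).
pose alpha4 := HdaPath (via_off_path m).
pose alpha5 := HdaPath (via_off_dead_path m).
have [beta2 [R2 _ run2]] : exists beta', [/\ R alpha2 beta', path_prefix beta beta'
    & run (edge true) (final beta) [:: Some c] (final beta')].
  apply: (hhp_forth half_R Rab); first by eexists; rewrite def_a.
  by rewrite def_a /= !label_make.
have [|beta3 R3 final3] := @hhp_sim _ _ _ _ _ alpha3 3 half_R R2.
  right; exists [:: (up 0, arrow (edge_side m)); (down 0, vtx (side m))], [::].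
  exists (up 0), (up 1), (up 0), (up 0), (arrow (edge_top m)), (arrow (edge_off m)).
  by exists (square_c m); split=> //; apply: (@sim_up 0 1).
have [beta4 [R4 _ run4]] : exists beta', [/\ R alpha4 beta', path_prefix beta' beta3
    & run (edge true) (final beta') [:: Some (act_of (~~ m))] (final beta3)].
  apply: (hhp_back half_R R3); first by eexists.
  by rewrite /= !label_make.
have [beta5 [R5 _ run5]] : exists beta', [/\ R alpha5 beta', path_prefix beta4 beta'
    & run (edge true) (final beta4) [:: Some d] (final beta')].
  apply: (hhp_forth half_R R4); first by eexists.
  by rewrite /= !label_make.
have run1 := hhp_init half_R Rab; rewrite def_a /= !label_make // in run1.
have run4' := hhp_init half_R R4; rewrite /= !label_make // in run4'.
move: run1 => [u1 step1 [u2 step2 def_u2]].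
move: run4' => [v1 step1' [v2 step2' def_v2]].
move: run2 run4 run5 => [w2 step3 def_w2] [w4 step4 def_w4] [w5 step5 _].
move: step3 step4 step5; rewrite def_w2 def_w4 final3 -def_u2 -def_v2.
have act_inj p q : Some (act_of p) = Some (act_of q) -> p = q.
  by case: p q => [] [] //= [] // /esym.
have act_c p : Some (act_of p) <> Some c by case: p => -[].
(* The labels leave [u2 = top j] and [v2 = off m k], both with an edge into [top' j]; the start of
   [d] then forces [k = true]. *)
case: u1 step1 step2 => //= n1 /act_inj ->{n1}.
case: u2 {def_u2} => [|?|j|?|n ?|?] //=; last first.
  by case: eqP => // _ [] /esym; case: (~~ m).
move=> _; case: v1 step1' step2' => //= n1 /act_inj ->{n1}.
case: v2 {def_v2} => [|?|?|?|n2 k|?] //=; first by move=> /act_c.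
case: eqP => // <-{n2} _; case: (final beta2) => //= j'.
case: eqP => // <-{j'} _; case: ifP => // /eqP -> _.
case: w5 => //= ?; first by case: ifP => // _ []; case: (~~ m).
by case: k => //= _; case: (m).
Qed.

(** The partner keeps its final vertex from [beta0] to [beta6], while [final_via_side] demands
    [top true] at one end and [top false] at the other. *)
Lemma twisted_not_hhp : ~ bisimilar hhp (twisted false) (twisted true).
Proof.
case=> R [half_R _].
pose alpha0 := HdaPath (via_side_path false).
pose alpha1 := HdaPath (via_side_top_path false).
pose alpha2 := HdaPath overlap_path_ba_ba.
pose alpha3 := HdaPath overlap_path_ba_ab.
pose alpha4 := HdaPath overlap_path_ab_ab.
pose alpha5 := HdaPath (via_side_top_path true).
pose alpha6 := HdaPath (via_side_path true).
have [beta0 [R0 _ _]] := @hhp_forth _ _ R _ _ alpha0 _ half_R half_R.1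
  (ex_intro _ _ erefl) erefl.
(* Ending an event starts nothing, so the run is empty and the final vertex unchanged. *)
have [beta1 [R1 _ run1]] := @hhp_forth _ _ R _ _ alpha1 [::] half_R R0
  (ex_intro _ _ erefl) erefl.
have [|beta2 R2 final2] := @hhp_sub _ _ _ _ _ alpha2 2 half_R R1.
  exists [:: (up 0, arrow (edge_side false))], [:: (down 0, vtx (top true))].
  exists (up 1), (down 0), (down 0), (up 0), square_ab, (vtx (side false)).
  by exists (arrow (edge_top false)); split=> //; apply: (@sub_gt 0 1).
have [|beta3 R3 final3] := @hhp_sim _ _ _ _ _ alpha3 3 half_R R2.
  left; exists [:: (up 0, arrow (edge_side false)); (up 1, square_ab)], [::].
  exists (down 1), (down 0), (down 0), (down 0), (arrow (edge_top true)).
  exists (arrow (edge_top false)), (vtx (top true)).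
  by split=> //; apply: (@sim_down 0 1).
have [|beta4 R4 final4] := @hhp_sim _ _ _ _ _ alpha4 1 half_R R3.
  right; exists [::], [:: (down 1, arrow (edge_top true)); (down 0, vtx (top true))].
  exists (up 0), (up 1), (up 0), (up 0), (arrow (edge_side false)).
  exists (arrow (edge_side true)), square_ab.
  by split=> //; apply: (@sim_up 0 1).
(* Sequentialization, the one clause hqhp lacks, carries the path over to the vertex [side true]. *)
have [|beta5 R5 final5] := @hhp_sup _ _ _ _ _ alpha5 2 half_R R4.
  exists [:: (up 0, arrow (edge_side true))], [:: (down 0, vtx (top true))].
  exists (up 0), (down 1), (down 0), (up 0), square_ab, (vtx (side true)).
  by exists (arrow (edge_top true)); split=> //; apply: (@sub_lt 0 1).
have [beta6 [R6 _ run6]] := @hhp_back _ _ R _ _ alpha6 [::] half_R R5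
  (ex_intro _ _ erefl) erefl.
move: (final_via_side half_R R0 erefl) (final_via_side half_R R6 erefl).
by move: run1 run6 => /= -> ->; rewrite final5 final4 final3 final2 => ->.
Qed.

End Example.

Theorem theorem5p15 (S : Type) (a b c d : S)
    (ab : a <> b) (ac : a <> c) (ad : a <> d)
    (bc : b <> c) (bd : b <> d) (cd : c <> d) :
  (forall Y Z : hda S, bisimilar hhp Y Z -> bisimilar hqhp Y Z) /\
  (exists Y Z : hda S, bisimilar hqhp Y Z /\ ~ bisimilar hhp Y Z).
Proof.
split.
  have half (Y Z : hda S) (R : hda_path Y -> hda_path Z -> Prop) :
      half_bisimulation hhp R -> half_bisimulation hqhp R.
    case=> R0 half_R; split=> // alpha beta /half_R[st ext sub _ [sim back]].
    split=> // [_||].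
    - by apply: sub; apply: Or41.
    - by case.
    - by split=> _; [apply: sim; apply: Or43 | apply: back; apply: Or44].
  by move=> Y Z [R [/half half_R /half half_R']]; exists R.
exists (twisted a b c d false), (twisted a b c d true).
by split; [apply: twisted_hqhp | apply: twisted_not_hhp].
Qed.
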